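(* Let $F$ be a field of characteristic zero, $G$ a finite group, and let $A$ be a unitary $(G,* )$-algebra over $F$ with quadratic codimension growth and of type $F+J(A)$. Let $g,h\in G\setminus\{1\}$ and $u\in G$ with $g\neq h$ and $h\neq u$, and in each item suppose that the two group elements involved commute. Then: (1) $m_{((1)_{g^+},(1)_{h^+})}=2$ if and only if $\mathcal{G}_{2,\psi}^{g,h}\oplus W_{\nu_1}^{g,h}\in\mathrm{var}^\sharp(A)$. (2) $m_{((1)_{u^-},(1)_{h^-})}=2$ if and only if $\mathcal{G}_{2,\tau}^{u,h}\oplus W_{\nu_2}^{u,h}\in\mathrm{var}^\sharp(A)$. (3) $m_{((1)_{u^-},(1)_{g^+})}=2$ if and only if $\mathcal{G}_{2,\gamma}^{u,g}\oplus W_{\nu_3}^{u,g}\in\mathrm{var}^\sharp(A)$.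
   Context: A $(G,* )$-algebra is an associative $G$-graded $F$-algebra $A=\bigoplus_{g\in G}A_g$ with an ($F$-linear) involution $*$ such that $A_g^*=A_g$; put $A_g^{\pm}=\{a\in A_g:a^*=\pm a\}$. Direct sums carry the componentwise grading and involution. Unitary means having a unit element; type $F+J(A)$ means $A=F\cdot 1+J(A)$ with $J(A)$ the Jacobson radical. The free $(G,* )$-algebra is the free associative algebra on variables $x_{i,g}^+$ (symmetric of degree $g$) and $x_{i,g}^-$ (skew of degree $g$), $i\ge1$, $g\in G$. $\mathrm{Id}^\sharp(A)$ is the set of its elements vanishing under all evaluations $x_{i,g}^\epsilon\mapsto a\in A_g^\epsilon$; $\mathrm{var}^\sharp(A)$ is the class of all $(G,* )$-algebras $B$ with $\mathrm{Id}^\sharp(A)\subseteq\mathrm{Id}^\sharp(B)$. $P_n^\sharp$ is the span of all $w_{\sigma(1)}\cdots w_{\sigma(n)}$, $\sigma\in S_n$, $w_i\in\{x_{i,g}^\pm:g\in G\}$; $c_n^\sharp(A)=\dim_FP_n^\sharp/(P_n^\sharp\cap\mathrm{Id}^\sharp(A))$; quadratic codimension growth means $c_n^\sharp(A)=qn^2+\mathcal{O}(n)$, $q>0$. A proper polynomial is a linear combination of products of variables and commutators of variables in which variables $x_{i,1}^+$ occur only inside commutators. For distinct symbols $s^\delta,t^\epsilon$, both different from $1^+$, $\Gamma_{(1_{s^\delta},1_{t^\epsilon})}$ is the space of multilinear proper polynomials in $x_{1,s}^\delta,x_{2,t}^\epsilon$ (with basis $x_{1,s}^\delta x_{2,t}^\epsilon$,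 $[x_{1,s}^\delta,x_{2,t}^\epsilon]$), and $m_{((1)_{s^\delta},(1)_{t^\epsilon})}$ is the multiplicity of the (unique) irreducible character $\chi_{(1)}\otimes\chi_{(1)}$ of $S_1\times S_1$ in $\Gamma_{(1_{s^\delta},1_{t^\epsilon})}/(\Gamma_{(1_{s^\delta},1_{t^\epsilon})}\cap\mathrm{Id}^\sharp(A))$, i.e. the dimension of this quotient. $\mathcal{G}_2$ is the unital algebra with basis $1,e_1,e_2,e_1e_2$ and $e_ie_j=-e_je_i$ (so $e_i^2=0$), with involutions determined by $\psi(e_i)=e_i$; $\tau(e_i)=-e_i$; $\gamma(e_i)=(-1)^ie_i$. For commuting $a,b\in G$ and $*\in\{\psi,\tau,\gamma\}$, $\mathcal{G}_{2,*}^{a,b}$ is $\mathcal{G}_2$ with involution $*$ and $1,e_1,e_2,e_1e_2$ of degrees $1,a,b,ab$. $W=\mathrm{span}_F\{I_4,\ e_{12}+e_{34},\ e_{13}+e_{24},\ e_{14}\}\subset UT_4(F)$; $\nu_1$ is the trivial involution; $\nu_2$ fixes $I_4,e_{14}$ and negates $e_{12}+e_{34}$, $e_{13}+e_{24}$; $\nu_3$ fixes $I_4$, $e_{13}+e_{24}$ and negates $e_{12}+e_{34}$, $e_{14}$. $W_{\nu_i}^{a,b}$ is $W$ with involution $\nu_i$ and $I_4,\ e_{12}+e_{34},\ e_{13}+e_{24},\ e_{14}$ of degrees $1,a,b,ab$. *)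

(* Defs.v *)
From HB Require Import structures.
From mathcomp Require Import all_boot all_order all_algebra all_fingroup.
From mathcomp Require Import Rstruct.
From mathcomp Require Import monalg.
From mathcomp Require Import ring.
From Stdlib Require Rdefinitions.

Set Implicit Arguments.
Unset Strict Implicit.
Unset Printing Implicit Defensive.

Import GRing.Theory Num.Theory.
Local Open Scope ring_scope.

Section LinearSpan.
Variables (F : fieldType) (V : lmodType F).

Definition lin_span (S : V -> Prop) (v : V) : Prop :=
  exists k (c : 'I_k -> F) (s : 'I_k -> V),
    (forall i, S (s i)) /\ v = \sum_(i < k) c i *: s i.

(* dim_F (S / U) = d, for subspaces U of S: some d vectors of S form a basis
   of S modulo U. *)
Definition quot_dim_is (S U : V -> Prop) (d : nat) : Prop :=
  exists b : 'I_d -> V,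
    [/\ forall i, S (b i),
        forall v, S v -> exists c : 'I_d -> F, U (v - \sum_(i < d) c i *: b i)
      & forall c : 'I_d -> F, U (\sum_(i < d) c i *: b i) -> forall i, c i = 0].

End LinearSpan.

Section JacobsonRadical.
Variable A : nzRingType.

Definition left_ideal (I : A -> Prop) : Prop :=
  [/\ I 0, forall x y, I x -> I y -> I (x + y) & forall a x, I x -> I (a * x)].

Definition maximal_left_ideal (I : A -> Prop) : Prop :=
  [/\ left_ideal I, ~ I 1
    & forall K : A -> Prop, left_ideal K -> ~ K 1 ->
        (forall x, I x -> K x) -> forall x, K x -> I x].

Definition jacobson_radical (x : A) : Prop :=
  forall I, maximal_left_ideal I -> I x.

End JacobsonRadical.

(* Unitary (G,* )-algebras over F, G being the whole of the finite group gT: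
   gscomp g is the homogeneous component A_g. *)
Record gsalg (F : fieldType) (gT : finGroupType) := GSAlg {
  gscarrier :> algType F;
  gscomp : gT -> gscarrier -> Prop;
  gsstar : gscarrier -> gscarrier;
  gscomp_linear : forall g (c : F) x y,
    gscomp g x -> gscomp g y -> gscomp g (c *: x + y);
  gscomp_span : forall x, exists xs : gT -> gscarrier,
    (forall g, gscomp g (xs g)) /\ x = \sum_g xs g;
  gscomp_direct : forall xs : gT -> gscarrier,
    (forall g, gscomp g (xs g)) -> \sum_g xs g = 0 -> forall g, xs g = 0;
  gscomp_mul : forall g h x y,
    gscomp g x -> gscomp h y -> gscomp (g * h)%g (x * y);
  gsstar_linear : linear gsstar;
  gsstar_mul : forall x y, gsstar (x * y) = gsstar y * gsstar x;
  gsstarK : involutive gsstar;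
  gsstar_comp : forall g x, gscomp g x -> gscomp g (gsstar x)
}.

(* (g, false) stands for g^+ and (g, true) for g^-. *)
Definition gsymbol (gT : finGroupType) : Type := (gT * bool)%type.
HB.instance Definition _ (gT : finGroupType) := Finite.on (gsymbol gT).

Definition psym (gT : finGroupType) (g : gT) : gsymbol gT := (g, false).
Definition nsym (gT : finGroupType) (g : gT) : gsymbol gT := (g, true).

Definition gvar (gT : finGroupType) : Type := (nat * gsymbol gT)%type.
HB.instance Definition _ (gT : finGroupType) := Choice.on (gvar gT).

Definition freegs (F : fieldType) (gT : finGroupType) :=
  {malg F[{fmonom (gvar gT)}]}.

Section GSAlgebras.
Variables (F : fieldType) (gT : finGroupType).
Implicit Types (A B : gsalg F gT) (s t : gsymbol gT) (f : freegs F gT).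

Definition gshomog A s (a : A) : Prop :=
  gscomp s.1 a /\ gsstar a = (if s.2 then - a else a).

Definition gsvar (i : nat) s : freegs F gT := << fmu (i, s) >>.

Definition gseval A (phi : gvar gT -> A) f : A :=
  mmap (in_alg A) (fun m : {fmonom (gvar gT)} => \prod_(x <- m) phi x) f.

Definition gsId A f : Prop :=
  forall phi : gvar gT -> A,
    (forall i s, gshomog s (phi (i, s))) -> gseval phi f = 0.

Definition in_gsvar A B : Prop := forall f, gsId A f -> gsId B f.

Definition multilin (n : nat) : freegs F gT -> Prop :=
  lin_span (fun f => exists (sigma : 'S_n) (w : 'I_n -> gsymbol gT),
    f = \prod_(i < n) gsvar (sigma i).+1 (w (sigma i))).

Definition gscodim_is A (n d : nat) : Prop :=
  quot_dim_is (multilin n) (fun f => multilin n f /\ gsId A f) d.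

Definition quadratic_growth A : Prop :=
  exists2 c : nat -> nat, forall n, gscodim_is A n (c n) &
  exists q C : Rdefinitions.R, 0 < q /\
    forall n : nat, (0 < n)%N -> `|(c n)%:R - q * n%:R ^+ 2| <= C * n%:R.

Definition type_F_plus_J A : Prop :=
  forall x : A, exists (c : F) (j : A), jacobson_radical j /\ x = c%:A + j.

(* Left-normed commutators: these span all iterated commutators. *)
Inductive gscommutator : freegs F gT -> Prop :=
| GSComm2 i s j t :
    gscommutator (gsvar i s * gsvar j t - gsvar j t * gsvar i s)
| GSCommS f i s of gscommutator f :
    gscommutator (f * gsvar i s - gsvar i s * f).

Definition proper_factor f : Prop :=
  (exists i s, s <> psym 1%g /\ f = gsvar i s) \/ gscommutator f.

Definition proper : freegs F gT -> Prop :=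
  lin_span (fun f => exists k (p : 'I_k -> freegs F gT),
    (forall i, proper_factor (p i)) /\ f = \prod_(i < k) p i).

Definition Gamma11 s t f : Prop :=
  lin_span (fun w => w = gsvar 1 s * gsvar 2 t \/ w = gsvar 2 t * gsvar 1 s) f
  /\ proper f.

(* m_{((1)_s, (1)_t)} = d. *)
Definition mult11_is A s t (d : nat) : Prop :=
  quot_dim_is (Gamma11 s t) (fun f => Gamma11 s t f /\ gsId A f) d.

End GSAlgebras.

Section DirectSum.
Variables (F : fieldType) (gT : finGroupType) (A B : gsalg F gT).

Definition dsum_comp (g : gT) (x : A * B) : Prop := gscomp g x.1 /\ gscomp g x.2.
Definition dsum_star (x : A * B) : A * B := (gsstar x.1, gsstar x.2).

Lemma dsum_comp_linear g (c : F) x y :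
  dsum_comp g x -> dsum_comp g y -> dsum_comp g (c *: x + y).
Proof. by case=> ? ? [? ?]; split; apply: gscomp_linear. Qed.

Lemma dsum_sumE (xs : gT -> A * B) :
  \sum_g xs g = (\sum_g (xs g).1, \sum_g (xs g).2).
Proof.
by rewrite -(raddf_sum fst) -(raddf_sum snd) -surjective_pairing.
Qed.

Lemma dsum_comp_span x : exists xs : gT -> A * B,
  (forall g, dsum_comp g (xs g)) /\ x = \sum_g xs g.
Proof.
have [xs [xsP xsE]] := gscomp_span x.1; have [ys [ysP ysE]] := gscomp_span x.2.
exists (fun g => (xs g, ys g)); split=> [g|]; first by split.
by rewrite dsum_sumE /= -xsE -ysE -surjective_pairing.
Qed.

Lemma dsum_comp_direct (xs : gT -> A * B) :
  (forall g, dsum_comp g (xs g)) -> \sum_g xs g = 0 -> forall g, xs g = 0.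
Proof.
move=> xsP; rewrite dsum_sumE => -[s1 s2] g; rewrite [xs g]surjective_pairing.
rewrite (gscomp_direct (fun g => (xsP g).1) s1).
by rewrite (gscomp_direct (fun g => (xsP g).2) s2).
Qed.

Lemma dsum_comp_mul g h x y :
  dsum_comp g x -> dsum_comp h y -> dsum_comp (g * h)%g (x * y).
Proof. by case=> ? ? [? ?]; split; apply: gscomp_mul. Qed.

Lemma dsum_star_linear : linear dsum_star.
Proof. by move=> c x y; rewrite /dsum_star /= !gsstar_linear. Qed.

Lemma dsum_star_mul x y : dsum_star (x * y) = dsum_star y * dsum_star x.
Proof. by rewrite /dsum_star /= !gsstar_mul. Qed.

Lemma dsum_starK : involutive dsum_star.
Proof. by move=> [x y]; rewrite /dsum_star /= !gsstarK. Qed.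

Lemma dsum_star_comp g x : dsum_comp g x -> dsum_comp g (dsum_star x).
Proof. by case=> ? ?; split; apply: gsstar_comp. Qed.

Definition gsdsum : gsalg F gT :=
  @GSAlg F gT (A * B)%type dsum_comp dsum_star dsum_comp_linear dsum_comp_span
    dsum_comp_direct dsum_comp_mul dsum_star_linear dsum_star_mul dsum_starK
    dsum_star_comp.

End DirectSum.

(* Algebras with coordinates on a basis v_0 = 1, v_1, v_2, v_3 = v_1 v_2 of
   respective degrees 1, a, b, ab. *)
Definition deg4 (gT : finGroupType) (a b : gT) (i : 'I_4) : gT :=
  nth 1%g [:: 1; a; b; a * b]%g i.

(* Multiplication by the signs +, (-1)^d1, (-1)^d2, (-1)^d3. *)
Definition sign4 (F : fieldType) (d1 d2 d3 : bool) (x : 'rV[F]_4) : 'rV[F]_4 :=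
  \row_i ((-1) ^+ nth false [:: false; d1; d2; d3] i * x 0 i).

Lemma rV4P (F : fieldType) (x y : 'rV[F]_4) :
  x 0 0 = y 0 0 -> x 0 1 = y 0 1 -> x 0 2 = y 0 2 -> x 0 3 = y 0 3 -> x = y.
Proof.
move=> h0 h1 h2 h3; apply/rowP => -[[|[|[|[|//]]]] p].
- by rewrite (_ : Ordinal p = 0) //; apply: val_inj.
- by rewrite (_ : Ordinal p = 1) //; apply: val_inj.
- by rewrite (_ : Ordinal p = 2) //; apply: val_inj.
- by rewrite (_ : Ordinal p = 3) //; apply: val_inj.
Qed.

Section Basis4.
Variables (F : fieldType) (gT : finGroupType) (a b : gT).
Variables (A : lmodType F) (coord4 : A -> 'rV[F]_4).
Hypotheses (coordL : linear coord4) (coordI : injective coord4).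
Variable (vec4 : 'rV[F]_4 -> A).
Hypothesis vecK : cancel vec4 coord4.

(* The span of the basis vectors of degree g. *)
Definition comp4 (g : gT) (x : A) : Prop :=
  forall i : 'I_4, coord4 x 0 i != 0 -> deg4 a b i = g.

Let coord0 : coord4 0 = 0.
Proof. by have := coordL (-1) 0 0; rewrite scaler0 addr0 scaleN1r addNr. Qed.

Let coordD x y : coord4 (x + y) = coord4 x + coord4 y.
Proof. by have := coordL 1 x y; rewrite !scale1r. Qed.

Let coord_sum (xs : gT -> A) :
  coord4 (\sum_g xs g) = \sum_g coord4 (xs g).
Proof. exact: (big_morph coord4 coordD coord0). Qed.

Lemma comp4_linear g (c : F) x y :
  comp4 g x -> comp4 g y -> comp4 g (c *: x + y).
Proof.
move=> hx hy i; rewrite coordL !mxE => nz.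
have [x0|/hx//] := eqVneq (coord4 x 0 i) 0.
by apply: hy; apply: contraNneq nz => ->; rewrite x0 mulr0 addr0.
Qed.

Lemma comp4_span x : exists xs : gT -> A,
  (forall g, comp4 g (xs g)) /\ x = \sum_g xs g.
Proof.
exists (fun g => vec4 (\row_i (coord4 x 0 i *+ (deg4 a b i == g)))); split.
  by move=> g i; rewrite vecK mxE; have [//|_] := eqVneq (deg4 a b i) g; rewrite mulr0n eqxx.
apply: coordI; rewrite coord_sum; apply/rowP => i; rewrite summxE.
rewrite (bigD1 (deg4 a b i)) //= vecK mxE eqxx mulr1n big1 ?addr0 // => g ng.
by rewrite vecK mxE eq_sym (negPf ng).
Qed.

Lemma comp4_direct (xs : gT -> A) :
  (forall g, comp4 g (xs g)) -> \sum_g xs g = 0 -> forall g, xs g = 0.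
Proof.
move=> xsP s0 g; apply: coordI; apply/rowP => i; rewrite coord0 mxE.
apply/eqP; apply/negPn/negP => nz; have ig := xsP _ _ nz.
have := coord_sum xs; rewrite s0 coord0 => /rowP/(_ i).
rewrite summxE (bigD1 g) //= big1 ?addr0 => [e|k kg].
  by rewrite -e mxE eqxx in nz.
apply/eqP; apply/negPn/negP => nzk; have := xsP _ _ nzk.
by rewrite ig => e; rewrite e eqxx in kg.
Qed.

(* Multiplicativity of the grading when the multiplication table is supported
   on 1 * v_i = v_i * 1 = v_i and v_1 v_2, v_2 v_1 \in F v_3. *)
Lemma comp4_mul (m : A -> A -> A) (p q : F) : commute a b ->
  (forall x y, [/\ coord4 (m x y) 0 0 = coord4 x 0 0 * coord4 y 0 0,
    coord4 (m x y) 0 1 = coord4 x 0 0 * coord4 y 0 1 + coord4 x 0 1 * coord4 y 0 0,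
    coord4 (m x y) 0 2 = coord4 x 0 0 * coord4 y 0 2 + coord4 x 0 2 * coord4 y 0 0
  & coord4 (m x y) 0 3 = coord4 x 0 0 * coord4 y 0 3 + coord4 x 0 3 * coord4 y 0 0
    + p * (coord4 x 0 1 * coord4 y 0 2) + q * (coord4 x 0 2 * coord4 y 0 1)]) ->
  forall g h x y, comp4 g x -> comp4 h y -> comp4 (g * h)%g (m x y).
Proof.
move=> cab mE g h x y hx hy; have [m0 m1 m2 m3] := mE x y.
have key i j k : (coord4 x 0 i * coord4 y 0 j != 0) ->
    deg4 a b k = (deg4 a b i * deg4 a b j)%g -> deg4 a b k = (g * h)%g.
  by rewrite mulf_eq0 negb_or => /andP[/hx <- /hy <-].
have addn0 (u v : F) : u + v != 0 -> (u != 0) || (v != 0).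
  by apply: contraNT; rewrite negb_or !negbK => /andP[/eqP-> /eqP->]; rewrite addr0.
have muln0 (u v : F) : u * v != 0 -> v != 0.
  by rewrite mulf_eq0 negb_or => /andP[].
move=> i nz; move: i nz => -[[|[|[|[|//]]]] pf].
- rewrite (_ : Ordinal pf = 0); last exact: val_inj.
  by rewrite m0 => /key; apply; rewrite /deg4 /= mulg1.
- rewrite (_ : Ordinal pf = 1); last exact: val_inj.
  by rewrite m1 => /addn0/orP[]/key; apply; rewrite /deg4 /= ?mulg1 ?mul1g.
- rewrite (_ : Ordinal pf = 2); last exact: val_inj.
  by rewrite m2 => /addn0/orP[]/key; apply; rewrite /deg4 /= ?mulg1 ?mul1g.
- rewrite (_ : Ordinal pf = 3); last exact: val_inj.
  rewrite m3 => /addn0/orP[/addn0/orP[/addn0/orP[]|/muln0]|/muln0]/key; apply;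
    by rewrite /deg4 /= ?mulg1 ?mul1g.
Qed.

Lemma comp4_sign d1 d2 d3 g x y : coord4 y = sign4 d1 d2 d3 (coord4 x) ->
  comp4 g x -> comp4 g y.
Proof.
by move=> yE hx i nz; apply: hx; apply: contraNneq nz => x0; rewrite yE mxE x0 mulr0.
Qed.

End Basis4.

Section Sign4.
Variables (F : fieldType) (d1 d2 d3 : bool).
Local Notation sign := (@sign4 F d1 d2 d3).

Lemma sign4_linear : linear sign.
Proof. by move=> c x y; apply/rowP => i; rewrite !mxE; ring. Qed.

Lemma sign4K : involutive sign.
Proof. by move=> x; apply/rowP => i; rewrite !mxE signrMK. Qed.

End Sign4.

Section Grassmann2.
Variable F : fieldType.

(* Row vectors of coordinates on the basis 1, e_1, e_2, e_1 e_2. *)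
Definition grass2 : Type := 'rV[F]_4.
HB.instance Definition _ := GRing.Lmodule.on grass2.

Implicit Types x y z : grass2.

Definition grass2_of (c0 c1 c2 c3 : F) : grass2 :=
  \row_i nth 0 [:: c0; c1; c2; c3] i.

Definition grass2_one : grass2 := grass2_of 1 0 0 0.

(* e_1 e_1 = e_2 e_2 = 0 and e_2 e_1 = - e_1 e_2. *)
Definition grass2_mul x y : grass2 :=
  grass2_of (x 0 0 * y 0 0)
            (x 0 0 * y 0 1 + x 0 1 * y 0 0)
            (x 0 0 * y 0 2 + x 0 2 * y 0 0)
            (x 0 0 * y 0 3 + x 0 3 * y 0 0 + x 0 1 * y 0 2 - x 0 2 * y 0 1).

Let mulA : associative grass2_mul.
Proof. by move=> x y z; apply: rV4P; rewrite !mxE /= ?mxE /=; ring. Qed.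
Let mul1 : left_id grass2_one grass2_mul.
Proof. by move=> x; apply: rV4P; rewrite !mxE /= ?mxE /=; ring. Qed.
Let mulr_1 : right_id grass2_one grass2_mul.
Proof. by move=> x; apply: rV4P; rewrite !mxE /= ?mxE /=; ring. Qed.
Let mulDl : left_distributive grass2_mul +%R.
Proof. by move=> x y z; apply: rV4P; rewrite !mxE /= ?mxE /=; ring. Qed.
Let mulDr : right_distributive grass2_mul +%R.
Proof. by move=> x y z; apply: rV4P; rewrite !mxE /= ?mxE /=; ring. Qed.
Let one_neq0 : grass2_one != 0.
Proof. by apply/eqP => /rowP/(_ 0)/eqP; rewrite !mxE oner_eq0. Qed.

HB.instance Definition _ := GRing.Zmodule_isNzRing.Build grass2
  mulA mul1 mulr_1 mulDl mulDr one_neq0.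

Let scaleAl (c : F) x y : c *: (x * y) = (c *: x) * y.
Proof. by apply: rV4P; rewrite !mxE /= ?mxE /=; ring. Qed.
HB.instance Definition _ := GRing.Lmodule_isLalgebra.Build F grass2 scaleAl.

Let scaleAr (c : F) x y : c *: (x * y) = x * (c *: y).
Proof. by apply: rV4P; rewrite !mxE /= ?mxE /=; ring. Qed.
HB.instance Definition _ := GRing.Lalgebra_isAlgebra.Build F grass2 scaleAr.

Definition grass2_coord x : 'rV[F]_4 := x.

(* The involution with e_i |-> (-1)^(d_i) e_i; it sends e_1 e_2 to
   (-1)^(d_1 + d_2) e_2 e_1. *)
Definition grass2_star (d1 d2 : bool) x : grass2 := sign4 d1 d2 (~~ (d1 (+) d2)) x.

Let starL d1 d2 : linear (grass2_star d1 d2).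
Proof. exact: sign4_linear. Qed.
Let starK d1 d2 : involutive (grass2_star d1 d2).
Proof. exact: sign4K. Qed.
Let starM d1 d2 x y :
  grass2_star d1 d2 (x * y) = grass2_star d1 d2 y * grass2_star d1 d2 x.
Proof. by apply: rV4P; rewrite !mxE /= ?mxE /=; case: d1 d2 => [] []; ring. Qed.

Variables (gT : finGroupType) (a b : gT).
Hypothesis cab : commute a b.

Let comp := comp4 a b grass2_coord.

Let coordL : linear grass2_coord. Proof. by []. Qed.
Let coordI : injective grass2_coord. Proof. by []. Qed.
Let vecK : cancel id grass2_coord. Proof. by []. Qed.

Let comp_linear g (c : F) x y : comp g x -> comp g y -> comp g (c *: x + y).
Proof. exact: comp4_linear. Qed.
Let comp_span x : exists xs : gT -> grass2,
  (forall g, comp g (xs g)) /\ x = \sum_g xs g.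
Proof. exact: (comp4_span a b coordL coordI vecK). Qed.
Let comp_direct (xs : gT -> grass2) :
  (forall g, comp g (xs g)) -> \sum_g xs g = 0 -> forall g, xs g = 0.
Proof. exact: comp4_direct. Qed.
Let star_comp d1 d2 g x : comp g x -> comp g (grass2_star d1 d2 x).
Proof. exact: comp4_sign. Qed.
Let comp_mul g h x y : comp g x -> comp h y -> comp (g * h)%g (x * y).
Proof.
apply: (comp4_mul (m := *%R) (p := 1) (q := -1) cab) => {}x {}y.
by split; rewrite !mxE //=; ring.
Qed.

Definition grass2_gsalg (d1 d2 : bool) : gsalg F gT :=
  @GSAlg F gT grass2 (comp4 a b grass2_coord) (grass2_star d1 d2)
    comp_linear comp_span comp_direct comp_mul
    (@starL d1 d2) (@starM d1 d2) (@starK d1 d2) (@star_comp d1 d2).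

Definition G2psi := grass2_gsalg false false.
Definition G2tau := grass2_gsalg true true.
Definition G2gamma := grass2_gsalg true false.

End Grassmann2.

Section AlgebraW.
Variable F : fieldType.

(* The matrix unit e_ij, with 1 <= i, j <= 4. *)
Definition eij (i j : nat) : 'M[F]_4 := delta_mx (inord i.-1) (inord j.-1).

Definition Wbasis : seq 'M[F]_4 :=
  [:: 1%:M; eij 1 2 + eij 3 4; eij 1 3 + eij 2 4; eij 1 4].

Definition Wpred : {pred 'M[F]_4} := [pred M | M \in <<Wbasis>>%VS].

(* The coordinates of an element of W can be read off its first row. *)
Definition Wcomb (c : 'rV[F]_4) : 'M[F]_4 := \sum_(i < 4) c 0 i *: Wbasis`_i.

Let WcombE c : Wcomb c = c 0 0 *: 1%:M + c 0 1 *: (eij 1 2 + eij 3 4)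
   + c 0 2 *: (eij 1 3 + eij 2 4) + c 0 3 *: eij 1 4.
Proof.
rewrite /Wcomb !big_ord_recl big_ord0 /= addr0 !addrA.
by congr (c 0 _ *: _ + c 0 _ *: _ + c 0 _ *: _ + c 0 _ *: _); apply: val_inj.
Qed.

Lemma row0_Wcomb c : row 0 (Wcomb c) = c.
Proof.
have i0 : inord 0 = 0 :> 'I_4 by apply: val_inj; rewrite /= inordK.
have i1 : inord 1 = 1 :> 'I_4 by apply: val_inj; rewrite /= inordK.
have i2 : inord 2 = 2 :> 'I_4 by apply: val_inj; rewrite /= inordK.
have i3 : inord 3 = 3 :> 'I_4 by apply: val_inj; rewrite /= inordK.
by apply: rV4P; rewrite WcombE /eij /= i0 i1 i2 i3 !mxE /=; ring.
Qed.

Lemma Wcomb_linear : linear Wcomb.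
Proof.
move=> c x y; rewrite /Wcomb scaler_sumr -big_split; apply: eq_bigr => i _ /=.
by rewrite !mxE scalerDl scalerA.
Qed.

Lemma WpredP M : reflect (M = Wcomb (row 0 M)) (M \in Wpred).
Proof.
apply: (iffP idP) => [|->]; rewrite inE.
  move=> /(coord_span (X := in_tuple Wbasis)) ME.
  have {ME} -> : M = Wcomb (\row_i coord (in_tuple Wbasis) i M).
    by rewrite {1}ME /Wcomb; apply: eq_bigr => i _; rewrite mxE.
  by rewrite row0_Wcomb.
rewrite /Wcomb; apply: memv_suml => i _; apply/memvZ/memv_span.
by apply: mem_nth.
Qed.

Lemma WcombM x y : Wcomb x *m Wcomb y = Wcomb (\row_i nth 0
  [:: x 0 0 * y 0 0; x 0 0 * y 0 1 + x 0 1 * y 0 0;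
      x 0 0 * y 0 2 + x 0 2 * y 0 0;
      x 0 0 * y 0 3 + x 0 3 * y 0 0 + x 0 1 * y 0 2 + x 0 2 * y 0 1] i).
Proof.
have eM i j k l : (j.-1 < 4)%N -> (k.-1 < 4)%N ->
    eij i j *m eij k l = eij i l *+ (j.-1 == k.-1)%N.
  by move=> hj hk; rewrite mul_delta_mx_cond -val_eqE /= !inordK.
rewrite !WcombE !mxE /=.
set n1 := eij 1 2 + _; set n2 := eij 1 3 + _; set n3 := eij 1 4.
have [m11 m12 m13] : [/\ n1 *m n1 = 0, n1 *m n2 = n3 & n1 *m n3 = 0].
  by split; rewrite ?(mulmxDl, mulmxDr) !eM //= ?addr0 ?add0r.
have [m21 m22 m23] : [/\ n2 *m n1 = n3, n2 *m n2 = 0 & n2 *m n3 = 0].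
  by split; rewrite ?(mulmxDl, mulmxDr) !eM //= ?addr0 ?add0r.
have [m31 m32 m33] : [/\ n3 *m n1 = 0, n3 *m n2 = 0 & n3 *m n3 = 0].
  by split; rewrite ?(mulmxDl, mulmxDr) !eM //= ?addr0 ?add0r.
rewrite !(mulmxDl, mulmxDr) -!scalemxAl -!scalemxAr !mul1mx !mulmx1.
rewrite m11 m12 m13 m21 m22 m23 m31 m32 m33 !scaler0 !addr0 !scalerA.
by apply/matrixP => i j; rewrite !mxE; ring.
Qed.

Let Wsubalg : GRing.subsemialg_closed Wpred.
Proof.
have W1 : 1 \in Wpred by rewrite inE; apply: memv_span; rewrite inE eqxx.
split=> // [|c u|u v hu hv].
- by split=> [|u v]; rewrite !inE; [apply: mem0v|apply: memvD].
- by rewrite !inE; apply: memvZ.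
- move/WpredP: hu => ->; move/WpredP: hv => ->.
  rewrite [_ * _]WcombM; apply/WpredP; by rewrite row0_Wcomb.
Qed.

Definition Walg : Type := {M : 'M[F]_4 | M \in Wpred}.
HB.instance Definition _ := SubChoice.on Walg.

HB.instance Definition _ :=
  GRing.SubChoice_isSubAlgebra.Build F 'M[F]_4 Wpred Walg Wsubalg.

Implicit Types x y : Walg.

(* Coordinates on the basis Wbasis, read off the first row. *)
Definition Wcoord x : 'rV[F]_4 := row 0 (\val x).

Lemma Wcomb_in c : Wcomb c \in Wpred.
Proof. by apply/WpredP; rewrite row0_Wcomb. Qed.

Definition Wof (c : 'rV[F]_4) : Walg := exist _ (Wcomb c) (Wcomb_in c).

Lemma WofK : cancel Wof Wcoord.
Proof. exact: row0_Wcomb. Qed.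

Lemma WcoordK : cancel Wcoord Wof.
Proof. by move=> x; apply/val_inj/esym/WpredP/(valP x). Qed.

Let coordL : linear Wcoord.
Proof. by move=> c x y; apply/rowP => i; rewrite !mxE. Qed.
Let coordI : injective Wcoord. Proof. exact: can_inj WcoordK. Qed.

Let WofL : linear Wof.
Proof. by move=> c x y; apply: coordI; rewrite coordL !WofK. Qed.

Lemma Wcoord_mul x y : Wcoord (x * y) = \row_i nth 0
  [:: Wcoord x 0 0 * Wcoord y 0 0;
      Wcoord x 0 0 * Wcoord y 0 1 + Wcoord x 0 1 * Wcoord y 0 0;
      Wcoord x 0 0 * Wcoord y 0 2 + Wcoord x 0 2 * Wcoord y 0 0;
      Wcoord x 0 0 * Wcoord y 0 3 + Wcoord x 0 3 * Wcoord y 0 0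
      + Wcoord x 0 1 * Wcoord y 0 2 + Wcoord x 0 2 * Wcoord y 0 1] i.
Proof.
have valE (z : Walg) : \val z = Wcomb (Wcoord z) by apply/WpredP/(valP z).
by rewrite {1}/Wcoord rmorphM /= !valE [X in row 0 X]WcombM row0_Wcomb.
Qed.

(* The linear map fixing I_4 and multiplying e_12 + e_34, e_13 + e_24, e_14
   by (-1)^d1, (-1)^d2, (-1)^(d1 + d2). *)
Definition Wstar (d1 d2 : bool) x : Walg :=
  Wof (sign4 d1 d2 (d1 (+) d2) (Wcoord x)).

Let starL d1 d2 : linear (Wstar d1 d2).
Proof. by move=> c x y; rewrite /Wstar coordL sign4_linear WofL. Qed.
Let starK d1 d2 : involutive (Wstar d1 d2).
Proof. by move=> x; rewrite /Wstar WofK sign4K WcoordK. Qed.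
Let starM d1 d2 x y : Wstar d1 d2 (x * y) = Wstar d1 d2 y * Wstar d1 d2 x.
Proof.
apply: coordI; rewrite Wcoord_mul /Wstar !WofK Wcoord_mul.
by apply: rV4P; rewrite !mxE /= ?mxE /=; case: d1 d2 => [] []; ring.
Qed.

Variables (gT : finGroupType) (a b : gT).
Hypothesis cab : commute a b.

Let comp := comp4 a b Wcoord.

Let comp_linear g (c : F) x y : comp g x -> comp g y -> comp g (c *: x + y).
Proof. exact: comp4_linear. Qed.
Let comp_span x : exists xs : gT -> Walg,
  (forall g, comp g (xs g)) /\ x = \sum_g xs g.
Proof. exact: (comp4_span a b coordL coordI WofK). Qed.
Let comp_direct (xs : gT -> Walg) :
  (forall g, comp g (xs g)) -> \sum_g xs g = 0 -> forall g, xs g = 0.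
Proof. exact: comp4_direct. Qed.
Let star_comp d1 d2 g x : comp g x -> comp g (Wstar d1 d2 x).
Proof. by apply: comp4_sign; exact: WofK. Qed.
Let comp_mul g h x y : comp g x -> comp h y -> comp (g * h)%g (x * y).
Proof.
apply: (comp4_mul (m := *%R) (p := 1) (q := 1) cab) => {}x {}y.
by split; rewrite Wcoord_mul !mxE //=; ring.
Qed.

Definition W_gsalg (d1 d2 : bool) : gsalg F gT :=
  @GSAlg F gT Walg (comp4 a b Wcoord) (Wstar d1 d2)
    comp_linear comp_span comp_direct comp_mul
    (@starL d1 d2) (@starM d1 d2) (@starK d1 d2) (@star_comp d1 d2).

Definition Wnu1 := W_gsalg false false.
Definition Wnu2 := W_gsalg true true.
Definition Wnu3 := W_gsalg true false.

End AlgebraW.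

(* Main.v *)
(* For symbols s and t other than 1^+, the multiplicity is 2 exactly when
   c ab + d ba = 0 for all a in A_s and b in A_t forces c = d = 0.
   Let B be one of the two 4-dimensional algebras, with basis 1, v_1, v_2,
   v_1 v_2 and v_2 v_1 = e v_1 v_2, where e = -1 for G_2 and e = 1 for W.
   If f is an identity of A and phi is an evaluation in B with values
   y_0 + y_1 v_1 + y_2 v_2 + y_3 v_1 v_2, then the values
   y_0 + y_1 z a + y_2 z b + (y_3 / 2) z^2 (ab + e ba) are admissible in A for
   every scalar z, so f vanishes there as a polynomial in z. Its coefficients of
   degree at most 2, taken for (a, b), (a, 0) and (0, b), determine the value of
   f under phi, and they force it to be 0 when there is no relation. Conversely,
   a relation c x_1 x_2 + d x_2 x_1 holding in A holds in G_2 and in W, whence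
   c - d = 0 and c + d = 0. *)

Require Import Defs.
From mathcomp Require Import all_boot all_order all_algebra all_fingroup.
From mathcomp Require Import finmap monalg.
From mathcomp Require Import ring.

Set Implicit Arguments.
Unset Strict Implicit.
Unset Printing Implicit Defensive.

Import GRing.Theory.
Local Open Scope ring_scope.

(** * Polynomial functions in characteristic zero *)

Section CharZero.
Variables (F : fieldType) (F_char0 : [pchar F] =i pred0).

Lemma natf_neq0_char0 n : (n.+1%:R : F) != 0.
Proof. by rewrite ((pcharf0P F).1 F_char0). Qed.

Lemma eqN_char0 (x : F) : x = - x -> x = 0.
Proof.
move=> /eqP; rewrite -subr_eq0 opprK -mulr2n -mulr_natl mulf_eq0.
by rewrite (negPf (natf_neq0_char0 1)) => /eqP.
Qed.

(* Comparing [P (2 c)] with [2 ^+ n * P c] lowers the degree of [P]. *)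
Lemma poly_fun_eq0 (V : lmodType F) n (v : nat -> V) :
  (forall c : F, \sum_(i < n) c ^+ i *: v i = 0) ->
  forall i, (i < n)%N -> v i = 0.
Proof.
elim: n v => [//|n IHn] v v0.
have lt_n i : (i < n)%N -> v i = 0.
  move=> lt_in.
  have /(IHn (fun i => (2 ^+ i - 2 ^+ n) *: v i))/(_ i lt_in)/eqP :
      forall c : F, \sum_(i < n) c ^+ i *: ((2 ^+ i - 2 ^+ n) *: v i) = 0.
    move=> c; have := congr2 (fun x y => x - 2 ^+ n *: y) (v0 (2 * c)) (v0 c).
    rewrite scaler0 subr0 scaler_sumr -sumrB big_ord_recr /= exprMn !scalerA.
    rewrite subrr addr0 => sum0; rewrite -[RHS]sum0; apply: eq_bigr => j _.
    by rewrite !scalerA -scalerBl exprMn; congr (_ *: _); ring.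
  rewrite scaler_eq0 subr_eq0 => /orP[/eqP two_pow|/eqP //].
  have: (2 ^ n - 2 ^ i)%:R = 0 :> F.
    by rewrite natrB ?leq_exp2l ?(ltnW lt_in) // !natrX two_pow subrr.
  move/eqP; rewrite ((pcharf0P F).1 F_char0) subn_eq0 leq_exp2l //.
  by rewrite leqNgt lt_in.
move=> i; rewrite ltnS leq_eqVlt => /orP[/eqP->|/lt_n//].
have := v0 1; rewrite big_ord_recr /= big1 => [|j _]; last first.
  by rewrite lt_n ?scaler0.
by rewrite expr1n scale1r add0r.
Qed.

(** Scalars [c%:A] are central, so these values are polynomial in [c] with vector coefficients, and
    [poly_fun_eq0] kills each coefficient. *)
Lemma poly_horner_eq0 (A : algType F) (p : {poly A}) :
  (forall c : F, p.[c%:A] = 0) -> p = 0.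
Proof.
move=> p0; apply/polyP => i; rewrite coef0.
have [|/(nth_default 0)//] := ltnP i (size p).
apply: (poly_fun_eq0 (v := fun i => p`_i)) => c.
rewrite -[RHS](p0 c) horner_coef; apply: eq_bigr => j _.
by rewrite exprZn expr1n mulr_algr.
Qed.

End CharZero.

(** * Noncommutative expansions up to degree two *)

Section Expansion.
Variables (F : fieldType) (e : F) (A : algType F).
Implicit Types (y z q : 'rV[F]_4) (a b : A).

(* Coordinates of a product on a basis 1, v_1, v_2, v_1 v_2 with
   v_1 v_1 = v_2 v_2 = 0 and v_2 v_1 = e v_1 v_2. *)
Definition mul4 y z : 'rV[F]_4 := \row_i nth 0
  [:: y 0 0 * z 0 0; y 0 0 * z 0 1 + y 0 1 * z 0 0;
      y 0 0 * z 0 2 + y 0 2 * z 0 0;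
      y 0 0 * z 0 3 + y 0 3 * z 0 0 + y 0 1 * z 0 2 + e * (y 0 2 * z 0 1)] i.

Definition one4 : 'rV[F]_4 := \row_i (i == 0)%:R.

Definition lin2 y a b : A := y 0 1 *: a + y 0 2 *: b.

(** Here [q] holds coefficients of the four words of degree two, with ab and ba kept apart, and not
    coordinates in a model. *)
Definition quad2 q a b : A :=
  \sum_(i < 4) q 0 i *: [:: a * a; a * b; b * a; b * b]`_i.

Lemma lin2_linear c y z a b :
  lin2 (c *: y + z) a b = c *: lin2 y a b + lin2 z a b.
Proof. by rewrite /lin2 !mxE !scalerDl scalerDr !scalerA addrACA. Qed.

Lemma quad2_linear c y z a b :
  quad2 (c *: y + z) a b = c *: quad2 y a b + quad2 z a b.
Proof.
rewrite /quad2 scaler_sumr -big_split; apply: eq_bigr => i _ /=.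
by rewrite !mxE scalerDl scalerA.
Qed.

Lemma lin2M y z a b : lin2 y a b * lin2 z a b =
  quad2 (\row_i [:: y 0 1 * z 0 1; y 0 1 * z 0 2; y 0 2 * z 0 1;
                    y 0 2 * z 0 2]`_i) a b.
Proof.
rewrite /quad2 !big_ord_recl big_ord0 !mxE /= addr0 /lin2.
by rewrite mulrDl !mulrDr -!scalerAl -!scalerAr !scalerA !addrA.
Qed.

(* The terms of degree at most 2 of a noncommutative polynomial in a, b,
   graded by powers of 'X, have the coordinates y when a, b are replaced by
   v_1, v_2. *)
Definition expands y (P : A -> A -> {poly A}) : Prop :=
  exists2 q : 'rV[F]_4, y 0 3 = q 0 1 + e * q 0 2 & forall a b,
    [/\ (P a b)`_0 = (y 0 0)%:A, (P a b)`_1 = lin2 y a b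
      & (P a b)`_2 = quad2 q a b].

Lemma expands1 : expands one4 (fun _ _ => 1).
Proof.
exists 0; first by rewrite !mxE mulr0 addr0.
move=> a b; rewrite !coef1 /lin2 /quad2 !mxE /= scale1r !scale0r addr0.
by split=> //; rewrite big1 // => i _; rewrite mxE scale0r.
Qed.

Lemma expandsM y z P Q : expands y P -> expands z Q ->
  expands (mul4 y z) (fun a b => P a b * Q a b).
Proof.
move=> [q yE PE] [r zE QE].
(* The degree 2 part of a product: degrees 2 + 0, 0 + 2 and 1 + 1, the last by [lin2M]. *)
exists (z 0 0 *: q + (y 0 0 *: r + \row_i [:: y 0 1 * z 0 1; y 0 1 * z 0 2;
  y 0 2 * z 0 1; y 0 2 * z 0 2]`_i)).
  by rewrite !mxE /= yE zE; ring.
move=> a b; have [P0 P1 P2] := PE a b; have [Q0 Q1 Q2] := QE a b.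
rewrite !coefM !big_ord_recl !big_ord0 /= !addr0 P0 P1 P2 Q0 Q1 Q2.
rewrite !mulr_algl !mulr_algr !scalerA !quad2_linear lin2M; split.
- by rewrite mxE.
- rewrite /lin2 !mxE /= !scalerDl !scalerDr !scalerA ![_ * z 0 0]mulrC.
  by rewrite addrACA.
- by rewrite [RHS]addrC addrA.
Qed.

Lemma expands_linear c y z P Q : expands y P -> expands z Q ->
  expands (c *: y + z) (fun a b => c%:A *: P a b + Q a b).
Proof.
move=> [q yE PE] [r zE QE]; exists (c *: q + r).
  by rewrite !mxE yE zE; ring.
move=> a b; have [P0 P1 P2] := PE a b; have [Q0 Q1 Q2] := QE a b.
rewrite !coefD !coefZ P0 P1 P2 Q0 Q1 Q2 lin2_linear quad2_linear !mulr_algl.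
by split; rewrite // !mxE scalerDl scalerA.
Qed.

Hypotheses (e_sqr : e * e = 1) (two_neq0 : (2%:R : F) != 0).

(** Both ab and e ba become v_1 v_2 in the model because [e * e = 1], whence the division by 2.
    Symmetrising gives the product term the same symbol as v_1 v_2. *)
Definition lift4 y a b : A :=
  (y 0 0)%:A + lin2 y a b + (y 0 3 / 2%:R) *: (a * b + e *: (b * a)).

Definition poly_lift4 y a b : {poly A} := \poly_(i < 3)
  [:: (y 0 0)%:A; lin2 y a b; (y 0 3 / 2%:R) *: (a * b + e *: (b * a))]`_i.

Lemma expands_lift y : expands y (poly_lift4 y).
Proof.
exists (\row_i [:: 0; y 0 3 / 2%:R; e * (y 0 3 / 2%:R); 0]`_i).
  rewrite !mxE /= mulrA e_sqr mul1r -mulrDr -mulr2n -mulr_natl.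
  by field.
move=> a b; rewrite !coef_poly /=; split=> //.
rewrite /quad2 !big_ord_recl big_ord0 !mxE /= !scale0r !addr0 add0r.
by rewrite scalerDr scalerA [_ * e]mulrC.
Qed.

(** The coefficient of ['X^i] is homogeneous of degree i in (a, b), so evaluating at [c] amounts to
    rescaling a and b. *)
Lemma horner_poly_lift y a b c :
  (poly_lift4 y a b).[c%:A] = lift4 y (c *: a) (c *: b).
Proof.
rewrite horner_poly !big_ord_recl big_ord0 /= addr0 expr0 mulr1 expr1.
rewrite exprZn expr1n !mulr_algr addrA; congr (_ + _ + _).
  by rewrite /lin2 scalerDr !scalerA ![c * _]mulrC.
have -> : c *: a * (c *: b) + e *: (c *: b * (c *: a)) =
    c ^+ 2 *: (a * b + e *: (b * a)).
  rewrite -!scalerAl -!scalerAr scalerDr !scalerA.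
  by congr (_ *: _ + _ *: _); ring.
by rewrite !scalerA mulrC.
Qed.

End Expansion.

(** * Linear spans and two-dimensional quotients *)

Section LinearSpanTheory.
Variables (F : fieldType) (V : lmodType F).
Implicit Types (S U : V -> Prop) (v w : V).

Lemma lin_span_mem S v : S v -> lin_span S v.
Proof.
move=> Sv; exists 1%N, (fun _ => 1), (fun _ => v).
by split=> //; rewrite big_ord1 scale1r.
Qed.

Lemma lin_span0 S : lin_span S 0.
Proof.
exists 0%N, (fun _ => 0), (fun _ => 0).
by split=> [[]//|]; rewrite big_ord0.
Qed.

Lemma lin_span_linear S c v w :
  lin_span S v -> lin_span S w -> lin_span S (c *: v + w).
Proof.
move=> [m [a [x [xS ->]]]] [n [b [y [yS ->]]]]; exists (m + n)%N.
exists (fun i => match split i with inl j => c * a j | inr j => b j end).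
exists (fun i => match split i with inl j => x j | inr j => y j end).
split=> [i|]; first by case: (split i).
rewrite big_split_ord scaler_sumr; congr (_ + _); apply: eq_bigr => i _.
  by rewrite (unsplitK (inl i)) scalerA.
by rewrite (unsplitK (inr i)).
Qed.

Lemma lin_span_pair v w u : lin_span (fun x => x = v \/ x = w) u ->
  exists c d, u = c *: v + d *: w.
Proof.
move=> [k [c [x [xP ->]]]].
apply: (big_ind (fun u => exists c d, u = c *: v + d *: w)) => [|y z|i _].
- by exists 0, 0; rewrite !scale0r addr0.
- move=> [c1 [d1 ->]] [c2 [d2 ->]]; exists (c1 + c2), (d1 + d2).
  by rewrite !scalerDl addrACA.
- have [->|->] := xP i; first by exists (c i), 0; rewrite scale0r addr0.
  by exists 0, (c i); rewrite scale0r add0r.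
Qed.

Lemma collinear2 (c d p q : F) : (c != 0) || (d != 0) -> c * q = d * p ->
  exists2 k, p = k * c & q = k * d.
Proof.
case/orP=> nz cq; [exists (p / c); first by rewrite divfK |
                   exists (q / d); last by rewrite divfK].
  by rewrite mulrAC [p * d]mulrC -cq mulrC mulKf.
by rewrite mulrAC [q * c]mulrC cq mulrC mulKf.
Qed.

(** A relation between [v] and [w] modulo [U] with coefficients not both zero would put a nontrivial
    combination of any two vectors of [S] into [U], against the independence of a basis. *)
Lemma quot_dim_pair S U v w :
  (forall u, S u -> exists c d, u = c *: v + d *: w) -> S v -> S w ->
  U 0 -> (forall c u, U u -> U (c *: u)) ->
  quot_dim_is S U 2 <->
  (forall c d, U (c *: v + d *: w) -> c = 0 /\ d = 0).
Proof.
move=> S_span Sv Sw U0 UZ; split; last first.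
  move=> indep; exists (fun i => if i == 0 then v else w); split.
  - by move=> i; case: ifP.
  - move=> u /S_span[c [d ->]]; exists (fun i => if i == 0 then c else d).
    by rewrite !big_ord_recl big_ord0 /= addr0 subrr.
  - move=> c; rewrite !big_ord_recl big_ord0 /= addr0 => /indep[c0 c1] i.
    case: i => [[|[|//]] lti]; first by rewrite -[RHS]c0; congr c; apply: val_inj.
    by rewrite -[RHS]c1; congr c; apply: val_inj.
move=> [b [bS _ b_indep]] c d Ucd.
have [p0 [q0 b0E]] := S_span _ (bS 0); have [p1 [q1 b1E]] := S_span _ (bS 1).
suff /andP[/eqP-> /eqP->] : (c == 0) && (d == 0) by [].
apply/negPn; rewrite negb_and; apply/negP => cd_neq0.
have U_multiple p q : c * q = d * p -> U (p *: v + q *: w).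
  move=> /(collinear2 cd_neq0)[k -> ->].
  by rewrite -!scalerA -scalerDr; apply: UZ.
(* The linear form whose kernel is the line through (c, d). *)
pose ell p q := d * p - c * q.
have [ell1 ell0] : ell p1 q1 = 0 /\ ell p0 q0 = 0.
  (* With these coefficients the combination of [b 0] and [b 1] is killed by [ell], hence lies in
     [U]. *)
  pose a (i : 'I_2) := if i == 0 then ell p1 q1 else - ell p0 q0.
  have a0 : forall i, a i = 0.
    apply: b_indep; rewrite !big_ord_recl big_ord0 /= addr0 b0E.
    rewrite (_ : lift _ _ = 1) ?b1E; last exact: val_inj.
    rewrite !scalerDr !scalerA addrACA -!scalerDl; apply: U_multiple.
    by rewrite /a /= /ell; ring.
  by split; [apply: (a0 0) | apply: oppr_inj; rewrite oppr0; apply: (a0 1)].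
have b_U i : U (b i).
  case: i => [[|[|//]] lti].
    rewrite (_ : Ordinal lti = 0) ?b0E; last exact: val_inj.
    by apply: U_multiple; apply/esym/eqP; rewrite -subr_eq0 -/(ell _ _) ell0.
  rewrite (_ : Ordinal lti = 1) ?b1E; last exact: val_inj.
  by apply: U_multiple; apply/esym/eqP; rewrite -subr_eq0 -/(ell _ _) ell1.
have /(b_indep (fun i => (i == 0)%:R))/(_ 0)/eqP :
    U (\sum_(i < 2) (i == 0)%:R *: b i).
  by rewrite !big_ord_recl big_ord0 /= scale1r scale0r !addr0.
by rewrite eqxx oner_eq0.
Qed.

End LinearSpanTheory.

(** * Evaluations, homogeneous elements, and multiplicity two as absence of a relation *)

Section Evaluation.
Variables (F : fieldType) (gT : finGroupType).
Implicit Types (A B : gsalg F gT) (r s t : gsymbol gT) (f : freegs F gT).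

Lemma gsevalE A (phi : gvar gT -> A) f :
  gseval phi f = \sum_(m <- msupp f) f@_m *: \prod_(x <- m) phi x.
Proof. by apply: eq_bigr => m _; rewrite mulr_algl. Qed.

Lemma gsevalD A (phi : gvar gT -> A) :
  {morph gseval phi : f1 f2 / f1 + f2}.
Proof. exact: mmapD. Qed.

Lemma gsevalZ A (phi : gvar gT -> A) c f :
  gseval phi (c *: f) = c *: gseval phi f.
Proof.
rewrite /gseval (mmapEw (msuppZ_le _ _)) mmapE scaler_sumr.
by apply: eq_bigr => m _; rewrite mcoeffZ /= !mulr_algl scalerA.
Qed.

Lemma gseval_var2 A (phi : gvar gT -> A) i j s t :
  gseval phi (gsvar F i s * gsvar F j t) = phi (i, s) * phi (j, t).
Proof.
rewrite /gsvar malgM_def fgmulUU mulr1 /gseval mmapU /= scale1r mul1r fmM !fmU.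
by rewrite big_cons big_seq1.
Qed.

Lemma gshomog_linear A r (c : F) (x y : A) :
  gshomog r x -> gshomog r y -> gshomog r (c *: x + y).
Proof.
move=> [xr xs] [yr ys]; split; first exact: gscomp_linear.
by rewrite gsstar_linear xs ys; case: r.2; rewrite // scalerN opprD.
Qed.

Lemma gshomog0 A r : gshomog r (0 : A).
Proof.
(* Decomposing 0 supplies some element of each component; subtracting it from itself shows that the
   component contains 0. *)
have [xs [xsP _]] := gscomp_span (0 : A).
have star0 : gsstar (0 : A) = 0.
  by rewrite -{1}[0](addNr 0) -scaleN1r gsstar_linear scaleN1r addNr.
split; last by rewrite star0 oppr0 if_same.
by rewrite -(addNr (xs r.1)) -scaleN1r; apply: gscomp_linear.
Qed.

Lemma gshomogZ A r (c : F) (x : A) : gshomog r x -> gshomog r (c *: x).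
Proof.
by move=> xr; rewrite -[_ *: _]addr0; apply/gshomog_linear/gshomog0.
Qed.

Lemma gshomogD A r (x y : A) : gshomog r x -> gshomog r y -> gshomog r (x + y).
Proof. by move=> xr yr; rewrite -[x]scale1r; apply: gshomog_linear. Qed.

Lemma gshomogZ_cond A r (c : F) (x : A) :
  (c != 0 -> gshomog r x) -> gshomog r (c *: x).
Proof.
have [->|_ /(_ isT)] := eqVneq c 0; last exact: gshomogZ.
by rewrite scale0r => _; apply: gshomog0.
Qed.

(* If 1 = \sum_g e_g, then x = \sum_g e_g x is a decomposition of a homogeneous
   x into distinct degrees, so that e_1 x = x. *)
Lemma gscomp1 A : gscomp 1%g (1 : A).
Proof.
have [es [esP oneE]] := gscomp_span (1 : A).
have e1x h (x : A) : gscomp h x -> es 1%g * x = x.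
  (* The degree [g] part of 1 x - x = 0; directness makes each part vanish, and the part of degree
     [h] gives the claim. *)
  move=> xh; pose ds g : A := es (g * h^-1)%g * x - (if g == h then x else 0).
  have ds0 g : ds g = 0.
    move: g; apply: gscomp_direct => [g|].
      rewrite /ds addrC -scaleN1r; apply: gscomp_linear.
        case: eqP => [->//|_]; exact: (gshomog0 A (g, false)).1.
      by rewrite -{1}[g](mulgKV h); apply: gscomp_mul.
    rewrite /ds sumrB -mulr_suml -big_mkcond big_pred1_eq.
    have <- : 1 = \sum_g es (g * h^-1)%g.
      by rewrite oneE (reindex_inj (mulIg h^-1)%g).
    by rewrite mul1r subrr.
  by have /eqP := ds0 h; rewrite /ds eqxx mulgV subr_eq0 => /eqP.
rewrite oneE -[X in gscomp _ X]mul1r oneE.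
have -> : (\sum_g es g) * (\sum_g es g) = es 1%g; last exact: esP.
rewrite -{1}oneE mul1r -[RHS]mulr1 oneE mulr_sumr.
by apply: eq_bigr => g _; rewrite (e1x g).
Qed.

Lemma gshomog1 A : gshomog (psym 1%g) (1 : A).
Proof.
split; first exact: gscomp1.
by have := gsstar_mul (gsstar (1 : A)) 1; rewrite mulr1 gsstarK mulr1 => <-.
Qed.

(** The involution exchanges xy and yx up to the signs of [s] and [t], and commutation puts both
    products in the same degree. *)
Lemma gshomog_mulC A s t (c : bool) (x y : A) : commute s.1 t.1 ->
  gshomog s x -> gshomog t y ->
  gshomog ((s.1 * t.1)%g, s.2 (+) t.2 (+) c) (x * y + (-1) ^+ c *: (y * x)).
Proof.
move=> cst [xs xstar] [yt ystar]; split=> /=.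
  rewrite addrC; apply: gscomp_linear; last exact: gscomp_mul.
  by rewrite cst; apply: gscomp_mul.
rewrite addrC gsstar_linear !gsstar_mul xstar ystar.
case: s.2 t.2 c {xs yt xstar ystar} => [] [] [];
  rewrite /= ?expr1 ?expr0 ?scaleN1r ?scale1r ?mulrNN ?mulNr ?mulrN ?opprD ?opprK //;
  by rewrite addrC.
Qed.

Definition point2 A s t (x y : A) (v : gvar gT) : A :=
  if v == (1%N, s) then x else if v == (2%N, t) then y else 0.

Lemma point2_homog A s t (x y : A) : gshomog s x -> gshomog t y ->
  forall i r, gshomog r (point2 s t x y (i, r)).
Proof.
move=> xs yt i r; rewrite /point2.
case: eqP => [[_ ->]//|_]; case: eqP => [[_ ->]//|_]; exact: gshomog0.
Qed.

Definition span2 s t (c d : F) : freegs F gT :=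
  c *: (gsvar F 1 s * gsvar F 2 t) + d *: (gsvar F 2 t * gsvar F 1 s).

Definition pair_free A s t : Prop := forall c d : F,
  (forall x y : A, gshomog s x -> gshomog t y ->
     c *: (x * y) + d *: (y * x) = 0) -> c = 0 /\ d = 0.

Lemma gseval_lin2 A (phi : gvar gT -> A) c d f1 f2 :
  gseval phi (c *: f1 + d *: f2) = c *: gseval phi f1 + d *: gseval phi f2.
Proof. by rewrite gsevalD !gsevalZ. Qed.

Lemma gseval_span2 A (phi : gvar gT -> A) s t c d :
  gseval phi (span2 s t c d) =
  c *: (phi (1%N, s) * phi (2%N, t)) + d *: (phi (2%N, t) * phi (1%N, s)).
Proof.
by rewrite /span2 gseval_lin2; congr (_ *: _ + _ *: _); apply: gseval_var2.
Qed.

Lemma gsId_span2 A s t c d : gsId A (span2 s t c d) <->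
  forall x y : A, gshomog s x -> gshomog t y ->
    c *: (x * y) + d *: (y * x) = 0.
Proof.
split=> [idA x y xs yt|cd0 phi phiP].
  have := idA _ (point2_homog xs yt).
  by rewrite gseval_span2 /point2 !eqxx.
by rewrite gseval_span2; apply: cd0; apply: phiP.
Qed.

Lemma proper_var2 i j s t : s <> psym 1%g -> t <> psym 1%g ->
  Defs.proper (gsvar F i s * gsvar F j t).
Proof.
move=> s1 t1; exists 1%N, (fun _ => 1), (fun _ => gsvar F i s * gsvar F j t).
split; last by rewrite big_ord1 scale1r.
move=> _; exists 2%N, (fun k => if k == 0 then gsvar F i s else gsvar F j t).
split; last by rewrite !big_ord_recl big_ord0 /= mulr1.
by move=> k; left; case: (k == 0); [exists i, s | exists j, t].
Qed.

Lemma Gamma11_linear s t c f1 f2 :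
  Gamma11 s t f1 -> Gamma11 s t f2 -> Gamma11 s t (c *: f1 + f2).
Proof. by move=> [? ?] [? ?]; split; apply: lin_span_linear. Qed.

Lemma Gamma11_0 s t : Gamma11 s t (0 : freegs F gT).
Proof. by split; apply: lin_span0. Qed.

Lemma Gamma11Z s t c f : Gamma11 s t f -> Gamma11 s t (c *: f).
Proof.
by move=> Gf; rewrite -[_ *: _]addr0; apply/Gamma11_linear/Gamma11_0.
Qed.

Lemma Gamma11_span2 s t c d : s <> psym 1%g -> t <> psym 1%g ->
  Gamma11 s t (span2 s t c d).
Proof.
move=> s1 t1.
have Gw f : f = gsvar F 1 s * gsvar F 2 t \/ f = gsvar F 2 t * gsvar F 1 s ->
    Gamma11 s t f.
  by move=> fE; split; [apply: lin_span_mem | case: fE => ->;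
    apply: proper_var2].
by apply: Gamma11_linear; [|apply: Gamma11Z]; apply: Gw; [left|right].
Qed.

(** Since neither symbol is 1^+, both words are proper and span [Gamma11]; an identity in their span
    is a relation in [A]. *)
Lemma mult11_2P A s t : s <> psym 1%g -> t <> psym 1%g ->
  mult11_is A s t 2 <-> pair_free A s t.
Proof.
move=> s1 t1.
rewrite /mult11_is (quot_dim_pair (v := gsvar F 1 s * gsvar F 2 t)
  (w := gsvar F 2 t * gsvar F 1 s)).
- split=> indep c d.
    move=> /gsId_span2 idA; apply: indep.
    by split=> //; apply: Gamma11_span2.
  by move=> [_ /gsId_span2]; apply: indep.
- by move=> f [/lin_span_pair].
- have := Gamma11_span2 1 0 s1 t1.
  by rewrite /span2 scale1r scale0r addr0.
- have := Gamma11_span2 0 1 s1 t1.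
  by rewrite /span2 scale1r scale0r add0r.
- by split=> [|phi _]; [apply: Gamma11_0 | apply: mmap0].
- move=> c f [Gf idf]; split=> [|phi phiP]; first exact: Gamma11Z.
  by rewrite gsevalZ idf ?scaler0.
Qed.

End Evaluation.

(** * Four-dimensional models and their identities *)

Section Models.
Variables (F : fieldType) (F_char0 : [pchar F] =i pred0) (gT : finGroupType).
Implicit Types (A B C : gsalg F gT) (r s t : gsymbol gT) (f : freegs F gT).

Let F2 : (2%:R : F) != 0. Proof. exact: natf_neq0_char0. Qed.

(** In the last entry, the symbol of v_1 v_2, the involution reverses the product, so restoring the
    order contributes [neg] to the sign. *)
Definition sym4 s t (neg : bool) (i : 'I_4) : gsymbol gT :=
  nth (psym 1%g) [:: psym 1%g; s; t; ((s.1 * t.1)%g, s.2 (+) t.2 (+) neg)] i.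

(* B has coordinates k on a basis 1, v_1, v_2, v_1 v_2 of homogeneous elements
   with v_1 of symbol s, v_2 of symbol t, v_1 v_1 = v_2 v_2 = 0 and
   v_2 v_1 = (-1) ^+ neg v_1 v_2. *)
Record model4 B s t (neg : bool) (k : B -> 'rV[F]_4) : Prop := Model4 {
  model4_linear : linear k;
  model4_inj : injective k;
  model4_surj : forall y, exists x, k x = y;
  model4_1 : k 1 = one4 F;
  model4_mul : forall x y, k (x * y) = mul4 ((-1) ^+ neg) (k x) (k y);
  model4_homog : forall r x,
    gshomog r x <-> forall i, k x 0 i != 0 -> sym4 s t neg i = r
}.

Section Model.
Variables (s t : gsymbol gT) (cst : commute s.1 t.1) (neg : bool).
Variables (B : gsalg F gT) (k : B -> 'rV[F]_4) (kB : model4 s t neg k).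
Variable A : gsalg F gT.
Let e : F := (-1) ^+ neg.
Let e_sqr : e * e = 1. Proof. by rewrite -signr_addb addbb. Qed.

Lemma model4_0 : k 0 = 0.
Proof.
by have := model4_linear kB (-1) 0 0; rewrite scaler0 addr0 scaleN1r addNr.
Qed.

(** Expansions respect products and linear combinations, so they pass from lifted variables to words
    and then to [f]. *)
Lemma expands_gseval (phi : gvar gT -> B) f :
  expands e (k (gseval phi f)) (fun a b : A => \sum_(m <- msupp f)
    (f@_m)%:A *: \prod_(x <- m) poly_lift4 e (k (phi x)) a b).
Proof.
rewrite gsevalE; elim: (enum_fset (msupp f)) => [|m ms IH].
  (* Zero is expanded as -1 + 1. The witness [q] is repacked because the functions are compared
     pointwise. *)
  have := expands_linear (-1) (expands1 e A) (expands1 e A).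
  rewrite scaleN1r addNr big_nil model4_0 => -[q qE q0]; exists q => // a b.
  by have := q0 a b; rewrite /= big_nil scaleN1r scaleN1r addNr.
rewrite big_cons (model4_linear kB).
have word : expands e (k (\prod_(x <- m) phi x))
    (fun a b : A => \prod_(x <- m) poly_lift4 e (k (phi x)) a b).
  elim: (fmonom_val m) => [|x xs IHxs].
    rewrite big_nil (model4_1 kB).
    by case: (expands1 e A) => q qE q1; exists q => // a b; rewrite big_nil.
  rewrite big_cons (model4_mul kB).
  have [q qE qM] := expandsM (expands_lift A e_sqr F2 (k (phi x))) IHxs.
  by exists q => // a b; rewrite big_cons; apply: qM.
have [q qE qD] := expands_linear f@_m word IH.
by exists q => // a b; rewrite big_cons; apply: qD.
Qed.

(** Each basis vector in the support of [k x] has symbol [r], and so does the element of [A]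
    replacing it. *)
Lemma lift4_homog r x (a b : A) : gshomog r x ->
  gshomog s a -> gshomog t b -> gshomog r (lift4 e (k x) a b).
Proof.
move=> /(model4_homog kB) rE sa tb.
have xr i (w : A) c : gshomog (sym4 s t neg i) w -> (c != 0 -> k x 0 i != 0) ->
    gshomog r (c *: w).
  by move=> iw nz; apply: gshomogZ_cond => /nz/rE <-.
rewrite /lift4 /lin2 addrA; do 3?apply: gshomogD.
- by apply: (xr 0) => //; apply: gshomog1.
- exact: (xr 1).
- exact: (xr 2).
- apply: (xr 3); first exact: gshomog_mulC.
  by apply: contraNneq => ->; rewrite mul0r.
Qed.

Lemma pair_free_in_gsvar : pair_free A s t -> in_gsvar A B.
Proof.
move=> freeA f idA phi phiP.
pose P (a b : A) : {poly A} := \sum_(m <- msupp f)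
  (f@_m)%:A *: \prod_(x <- m) poly_lift4 e (k (phi x)) a b.
have P0 (a b : A) : gshomog s a -> gshomog t b -> P a b = 0.
  move=> sa tb; apply: (poly_horner_eq0 F_char0) => c.
  (* The value at each scalar [c] is an admissible evaluation of the identity [f] in [A]. *)
  rewrite -[RHS](idA (fun x => lift4 e (k (phi x)) (c *: a) (c *: b))); last first.
    by move=> i r; apply: lift4_homog (phiP i r) _ _; apply: gshomogZ.
  rewrite gsevalE horner_sum; apply: eq_bigr => m _.
  rewrite hornerZ mulr_algl; congr (_ *: _).
  elim: (fmonom_val m) => [|x xs IH]; first by rewrite !big_nil hornerC.
  rewrite !big_cons hornerM_comm ?IH ?horner_poly_lift //.
  by rewrite /comm_poly mulr_algl mulr_algr.
have [q y3E Pq] := expands_gseval phi f; set y := k _ in y3E Pq.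
have a0 : gshomog s (0 : A) by apply: gshomog0.
have b0 : gshomog t (0 : A) by apply: gshomog0.
have quad0 (a b : A) : gshomog s a -> gshomog t b ->
  [/\ (y 0 0)%:A = 0 :> A, lin2 y a b = 0 & quad2 q a b = 0].
  move=> sa tb; have [] := Pq a b.
  by rewrite -/(P a b) P0 // !coef0 => <- <- <-.
have y0 : y 0 0 = 0.
  have [/eqP + _ _] := quad0 0 0 a0 b0.
  by rewrite scaler_eq0 oner_eq0 orbF => /eqP.
(* Otherwise every element of [A] of symbol [s] would be 0, and ab = 0 would be a relation. The next
   coordinate is symmetric. *)
have y1 : y 0 1 = 0.
  have [//|nz] := eqVneq (y 0 1) 0.
  have [] // := freeA 1 0; last by move=> /eqP; rewrite oner_eq0.
  move=> a b sa tb; have [_ + _] := quad0 a 0 sa b0.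
  rewrite /lin2 scaler0 addr0 => /eqP; rewrite scaler_eq0 (negPf nz) => /eqP ->.
  by rewrite mul0r !mulr0 !scaler0 addr0.
have y2 : y 0 2 = 0.
  have [//|nz] := eqVneq (y 0 2) 0.
  have [] // := freeA 1 0; last by move=> /eqP; rewrite oner_eq0.
  move=> a b sa tb; have [_ + _] := quad0 0 b a0 tb.
  rewrite /lin2 scaler0 add0r => /eqP; rewrite scaler_eq0 (negPf nz) => /eqP ->.
  by rewrite mul0r !mulr0 !scaler0 addr0.
have quadE (a b : A) : quad2 q a b = q 0 0 *: (a * a) + q 0 1 *: (a * b)
    + q 0 2 *: (b * a) + q 0 3 *: (b * b).
  rewrite /quad2 !big_ord_recl big_ord0 /= addr0 !addrA.
  by congr (q 0 _ *: _ + q 0 _ *: _ + q 0 _ *: _ + q 0 _ *: _); apply: val_inj.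
(* The pairs (a, 0) and (0, b) remove the squares, leaving a relation between ab and ba. *)
have [q1 q2] : q 0 1 = 0 /\ q 0 2 = 0.
  apply: freeA => a b sa tb.
  have [_ _ +] := quad0 a 0 sa b0; have [_ _ +] := quad0 0 b a0 tb.
  have [_ _ +] := quad0 a b sa tb; rewrite !quadE.
  rewrite !(mul0r, mulr0, scaler0, addr0, add0r) => quad_ab quad_b quad_a.
  by move: quad_ab; rewrite quad_a quad_b addr0 add0r.
apply: (model4_inj kB); rewrite model4_0 -/y.
by apply: rV4P; rewrite ?y0 ?y1 ?y2 ?y3E ?q1 ?q2 ?mulr0 ?addr0 mxE.
Qed.

(** The relation passes to [B]; at (v_1, v_2) its coefficient of v_1 v_2 is the asserted sum. *)
Lemma in_gsvar_relation c d : in_gsvar A B ->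
  (forall a b : A, gshomog s a -> gshomog t b ->
     c *: (a * b) + d *: (b * a) = 0) -> c + d * e = 0.
Proof.
move=> subAB /gsId_span2/subAB/gsId_span2 idB.
have [v1 v1E] := model4_surj kB (delta_mx 0 1).
have [v2 v2E] := model4_surj kB (delta_mx 0 2).
have v1s : gshomog s v1.
  apply/(model4_homog kB) => i; rewrite v1E mxE eqxx /=.
  by have [->|_] := eqVneq i _; rewrite ?eqxx.
have v2t : gshomog t v2.
  apply/(model4_homog kB) => i; rewrite v2E mxE eqxx /=.
  by have [->|_] := eqVneq i _; rewrite ?eqxx.
have /(congr1 (fun x => k x 0 3)) := idB v1 v2 v1s v2t.
rewrite (model4_linear kB) -[d *: _]addr0 (model4_linear kB) model4_0.
rewrite !(model4_mul kB) v1E v2E !mxE /= => rel.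
by rewrite -[RHS]rel !(mulr0, mul0r, mulr1, addr0, add0r).
Qed.

End Model.

(** * Identities of direct sums and the criterion for multiplicity two *)

Lemma gseval_dsum B C (phi : gvar gT -> gsdsum B C) f :
  gseval phi f = (gseval (A := B) (fun x => (phi x).1) f,
                  gseval (A := C) (fun x => (phi x).2) f).
Proof.
rewrite !gsevalE; elim/big_rec3: _ => [//|m z y x _ ->].
suff -> : \prod_(w <- m) phi w =
    (\prod_(w <- m) (phi w).1, \prod_(w <- m) (phi w).2) by [].
elim: (fmonom_val m) => [|w ws IH]; first by rewrite !big_nil.
by rewrite !big_cons IH.
Qed.

Lemma gsId_dsum B C f : gsId (gsdsum B C) f <-> gsId B f /\ gsId C f.
Proof.
have homogE r (x : gsdsum B C) :
    gshomog r x <-> gshomog r (x.1 : B) /\ gshomog r (x.2 : C).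
  case: x => x y; rewrite /gshomog /=; split.
    by case: r => r [] /= [[? ?] [? ?]].
  by case: r => r [] /= [[? ?] [? ?]]; split=> //; congr (_, _).
split=> [idBC|[idB idC] phi phiP]; last first.
  rewrite gseval_dsum idB ?idC // => i r; have /homogE[] := phiP i r; by [].
split=> phi phiP.
  (* An evaluation in one summand extends by 0, which is homogeneous of every symbol. *)
  have /(_ _)/(congr1 fst) := idBC (fun x => (phi x, 0)).
  rewrite gseval_dsum; apply=> i r; apply/homogE.
  by split; [apply: phiP | apply: gshomog0].
have /(_ _)/(congr1 snd) := idBC (fun x => (0, phi x)).
rewrite gseval_dsum; apply=> i r; apply/homogE.
by split; [apply: gshomog0 | apply: phiP].
Qed.

Lemma mult11_2_in_gsvar A B C s t (k : B -> 'rV[F]_4) (l : C -> 'rV[F]_4) :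
  commute s.1 t.1 -> s <> psym 1%g -> t <> psym 1%g ->
  model4 s t true k -> model4 s t false l ->
  mult11_is A s t 2 <-> in_gsvar A (gsdsum B C).
Proof.
move=> cst s1 t1 kB lC; rewrite mult11_2P //; split=> [freeA f idA|subA c d rel].
  have subAB := pair_free_in_gsvar cst kB freeA.
  have subAC := pair_free_in_gsvar cst lC freeA.
  by apply/gsId_dsum; split; [apply: subAB | apply: subAC].
have subAB : in_gsvar A B by move=> f /subA/gsId_dsum[].
have subAC : in_gsvar A C by move=> f /subA/gsId_dsum[].
have /eqP := in_gsvar_relation kB subAB rel.
have /eqP := in_gsvar_relation lC subAC rel.
rewrite expr0 expr1 mulr1 mulrN1 subr_eq0 addr_eq0 => /eqP cN /eqP cd.
have d0 : d = 0 by apply: (eqN_char0 F_char0); rewrite -cN.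
by rewrite cd.
Qed.

(** * The algebras G_2 and W as models *)

Lemma sign4_homog d1 d2 d3 (c : bool) (y : 'rV[F]_4) :
  sign4 d1 d2 d3 y = (if c then - y else y) <->
  forall i, y 0 i != 0 -> nth false [:: false; d1; d2; d3] i = c.
Proof.
have -> : (if c then - y else y) = (-1) ^+ c *: y.
  by case: c; rewrite ?expr1 ?scaleN1r ?expr0 ?scale1r.
split=> [/rowP yE i nz|ic].
  have /eqP := yE i; rewrite !mxE (inj_eq (mulIf nz)).
  (* Different signs would give 1 = -1, excluded in characteristic zero. *)
  case: (nth _ _ _) c {yE} => [] [] //; rewrite ?expr1 ?expr0 => /eqP.
    by move/esym=> N1; move: (oner_neq0 F); rewrite (eqN_char0 F_char0 N1) eqxx.
  by move=> N1; move: (oner_neq0 F); rewrite (eqN_char0 F_char0 N1) eqxx.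
apply/rowP => i; rewrite !mxE; have [->|/ic ->//] := eqVneq (y 0 i) 0.
by rewrite !mulr0.
Qed.

Lemma sym4E a b d1 d2 neg (i : 'I_4) : sym4 (a, d1) (b, d2) neg i =
  (deg4 a b i, nth false [:: false; d1; d2; d1 (+) d2 (+) neg] i).
Proof. by case: i => [[|[|[|[|//]]]] ?]. Qed.

(** Degree and involution act diagonally on the basis, so both conditions are tested on each nonzero
    coordinate. *)
Lemma homog4 (V : lmodType F) (k : V -> 'rV[F]_4) (star : V -> V) a b d1 d2 neg :
  linear k -> injective k ->
  (forall x, k (star x) = sign4 d1 d2 (d1 (+) d2 (+) neg) (k x)) ->
  forall (r : gsymbol gT) x,
  comp4 a b k r.1 x /\ star x = (if r.2 then - x else x) <->
  forall i, k x 0 i != 0 -> sym4 (a, d1) (b, d2) neg i = r.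
Proof.
move=> kL kI kstar r x.
have kN : k (- x) = - k x.
  have k0 : k 0 = 0 by have := kL (-1) 0 0; rewrite scaler0 addr0 scaleN1r addNr.
  by have := kL (-1) x 0; rewrite !addr0 !scaleN1r k0 addr0.
have -> : star x = (if r.2 then - x else x) <->
    sign4 d1 d2 (d1 (+) d2 (+) neg) (k x) = (if r.2 then - k x else k x).
  rewrite -kstar; case: r.2; rewrite -?kN; split=> [->//|]; exact: kI.
rewrite sign4_homog; split=> [[xr xs] i nz|xr].
  by rewrite sym4E (xr i nz) (xs i nz); case: r {xr xs}.
by split=> i /xr <-; rewrite sym4E.
Qed.

Lemma grass2_model a b (cab : commute a b) d1 d2 :
  model4 (B := grass2_gsalg F cab d1 d2) (a, d1) (b, d2) true (@grass2_coord F).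
Proof.
split=> //.
- by move=> y; exists y.
- by apply/rowP => i; rewrite !mxE; case: i => [[|[|[|[|//]]]] ?].
- by move=> x y; apply: rV4P; rewrite !mxE //= expr1; ring.
- move=> r x; apply: homog4 => // {}x.
  by rewrite /grass2_coord /grass2_star addbT.
Qed.

Lemma W_model a b (cab : commute a b) d1 d2 :
  model4 (B := W_gsalg F cab d1 d2) (a, d1) (b, d2) false (@Wcoord F).
Proof.
have coordL : linear (@Wcoord F) by move=> c x y; apply/rowP => i; rewrite !mxE.
have coordI : injective (@Wcoord F) := can_inj (@WcoordK F).
split=> //.
- by move=> y; exists (Wof y); apply: WofK.
- by apply/rowP => i; rewrite !mxE eq_sym.
- by move=> x y; rewrite Wcoord_mul; apply: rV4P; rewrite !mxE //= expr0 mul1r.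
- move=> r x; apply: homog4 => // {}x.
  by rewrite WofK addbF.
Qed.

End Models.

Theorem lemma4p6 (F : fieldType) (F_char0 : [pchar F] =i pred0)
    (gT : finGroupType) (A : gsalg F gT)
    (A_growth : quadratic_growth A) (A_type : type_F_plus_J A)
    (g h u : gT) (g_neq1 : g <> 1%g) (h_neq1 : h <> 1%g)
    (g_neq_h : g <> h) (h_neq_u : h <> u) :
  [/\ forall cgh : commute g h,
        mult11_is A (psym g) (psym h) 2 <->
        in_gsvar A (gsdsum (G2psi F cgh) (Wnu1 F cgh)),
      forall cuh : commute u h,
        mult11_is A (nsym u) (nsym h) 2 <->
        in_gsvar A (gsdsum (G2tau F cuh) (Wnu2 F cuh))
    & forall cug : commute u g,
        mult11_is A (nsym u) (psym g) 2 <->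
        in_gsvar A (gsdsum (G2gamma F cug) (Wnu3 F cug))].
Proof.
have p1 x : x <> 1%g -> psym x <> psym 1%g :> gsymbol gT by move=> x1 [].
(* A skew symbol differs from 1^+ by its sign, whatever its degree; this covers [u]. *)
have n1 x : nsym x <> psym 1%g :> gsymbol gT by [].
by split=> cab; apply: (mult11_2_in_gsvar F_char0) => //; try exact: p1;
  do [apply: grass2_model | apply: W_model].
Qed.
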